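(* Let $B$ and $D$ be two indecomposable subbimodules of ${}_AA_A$. Then $B\otimes_A D\cong BD$, and $BD$ is either zero or an indecomposable subbimodule of ${}_AA_A$.
   Context: $\Bbbk$ is an algebraically closed field. $Q$ is an oriented connected tree with vertex set $Q_0=\{1,2,\dots,n\}$, $n>1$. $\mathbf{K}(Q)$ is the set of all vertices that are sinks or sources, and $\mathbf{K}'(Q)$ is the set of all $i\in\mathbf{K}(Q)$ with $\deg_Q(i)\geq 2$. $Q$ is assumed to be admissible: every vertex of degree at least $3$ belongs to $\mathbf{K}(Q)$. It is also assumed that $\mathbf{K}'(Q)\neq\varnothing$ (equivalently, $Q$ is not isomorphic to $1\to 2\to\dots\to m$). $A$ is the path algebra of $Q$ over $\Bbbk$. Subbimodules of ${}_AA_A$ are the two-sided ideals of $A$; $BD$ denotes the product of ideals. *)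

(* Defs.v *)
From HB Require Import structures.
From mathcomp Require Import all_boot all_order all_algebra all_field.
From mathcomp Require Import boolp.
From mathcomp.multinomials Require Import freeg.

Set Implicit Arguments.
Unset Strict Implicit.
Unset Printing Implicit Defensive.

Import GRing.Theory.
Local Open Scope ring_scope.
Local Open Scope quotient_scope.

HB.mixin Record Zmodule_isBimodule (R S : pzRingType) V of GRing.Zmodule V := {
  lact : R -> V -> V;
  ract : V -> S -> V;
  lactA : forall a b v, lact (a * b) v = lact a (lact b v);
  lact1 : forall v, lact 1 v = v;
  lactDr : forall a v w, lact a (v + w) = lact a v + lact a w;
  lactDl : forall a b v, lact (a + b) v = lact a v + lact b v;
  ractA : forall v s t, ract v (s * t) = ract (ract v s) t;
  ract1 : forall v, ract v 1 = v;
  ractDl : forall v w s, ract (v + w) s = ract v s + ract w s;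
  ractDr : forall v s t, ract v (s + t) = ract v s + ract v t;
  lract : forall a v s, lact a (ract v s) = ract (lact a v) s
}.

#[short(type="bimodType")]
HB.structure Definition Bimodule (R S : pzRingType) :=
  {V of GRing.Zmodule V & Zmodule_isBimodule R S V}.

Definition bimod_iso (R S : pzRingType) (M N : bimodType R S) : Prop :=
  exists f : {additive M -> N},
    [/\ bijective f,
        forall a m, f (lact a m) = lact a (f m)
      & forall m s, f (ract m s) = ract (f m) s].

Section Tensor.
Variables (R S T : pzRingType) (M : bimodType R S) (N : bimodType S T).

Local Notation "m ** n" := (<< ((m, n) : M * N) >> : {freeg (M * N)%type})
  (at level 40).

(* The subgroup of the free abelian group on M * N generated by the relations
   that make the quotient biadditive and S-balanced. *)
Inductive tensor_rel : {freeg (M * N)%type} -> Prop :=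
  | TensorDl m m' n : tensor_rel ((m + m') ** n - m ** n - m' ** n)
  | TensorDr m n n' : tensor_rel (m ** (n + n') - m ** n - m ** n')
  | TensorBal m s n : tensor_rel (ract m s ** n - m ** lact s n)
  | Tensor0 : tensor_rel 0
  | TensorB x y : tensor_rel x -> tensor_rel y -> tensor_rel (x - y).

Definition tensor_relb : {pred {freeg (M * N)%type}} := fun x => `[< tensor_rel x >].

Fact tensor_relb_closed : zmod_closed tensor_relb.
Proof.
split=> [|x y /asboolP rx /asboolP ry]; apply/asboolP; first exact: Tensor0.
exact: TensorB.
Qed.
HB.instance Definition _ :=
  GRing.isZmodClosed.Build {freeg (M * N)%type} tensor_relb tensor_relb_closed.

Definition tensor : Type := Quotient.quot tensor_relb.
HB.instance Definition _ := GRing.Zmodule.on tensor.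
HB.instance Definition _ := EqQuotient.on tensor.

Definition tpure (m : M) (n : N) : tensor := \pi_tensor (m ** n).

Fact tensor_pi_eq x y : tensor_rel (x - y) -> \pi_tensor x = \pi_tensor y.
Proof.
move=> r; apply/eqP; rewrite -[_ == _](Quotient.idealrBE tensor_relb).
exact/asboolP.
Qed.

Fact tensor_pi_rel x y : \pi_tensor x = \pi_tensor y -> tensor_rel (x - y).
Proof.
by move/eqP; rewrite -[_ == _](Quotient.idealrBE tensor_relb) => /asboolP.
Qed.

Fact tensor_piB x y : \pi_tensor (x - y) = \pi_tensor x - \pi_tensor y.
Proof. exact: (raddfB \pi_(Quotient.quot tensor_relb)). Qed.

Fact tensor_pi0 : \pi_tensor 0 = 0.
Proof. exact: (raddf0 \pi_(Quotient.quot tensor_relb)). Qed.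

Fact freeg_ind (P : {freeg (M * N)%type} -> Prop) :
  P 0 -> (forall m n, P (m ** n)) -> (forall x y, P x -> P y -> P (x - y)) ->
  forall x, P x.
Proof.
move=> P0 P1 PB x.
have PN y : P y -> P (- y) by move=> Py; rewrite -[- y]add0r; apply: PB.
have PD y z : P y -> P z -> P (y + z).
  by move=> Py Pz; rewrite -[z]opprK; apply/PB/PN.
rewrite -[x]freeg_sumE; elim/big_ind: _ => // -[m n] _.
rewrite -[coeff _ _]intz -freegU_mulz.
have Pn k : P (m ** n *+ k) by elim: k => [|k IH] //; rewrite mulrS; apply: PD.
by case: (coeff _ _) => k; rewrite ?NegzE ?mulrNz -pmulrn //; apply: PN.
Qed.

Fact tensor_ind (P : tensor -> Prop) :
  P 0 -> (forall m n, P (tpure m n)) -> (forall x y, P x -> P y -> P (x - y)) ->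
  forall t, P t.
Proof.
move=> P0 P1 PB t; rewrite -[t]reprK; elim/freeg_ind: (repr t) => //.
  by rewrite tensor_pi0.
by move=> x y Px Py; rewrite tensor_piB; apply: PB.
Qed.

Section Endo.
Variables (g : M -> M) (h : N -> N).

Definition freeg_map : {freeg (M * N)%type} -> {freeg (M * N)%type} :=
  fglift (fun mn : M * N => g mn.1 ** h mn.2).

Definition tensor_map (t : tensor) : tensor := \pi_tensor (freeg_map (repr t)).

Hypothesis gD : {morph g : x y / x + y}.
Hypothesis hD : {morph h : x y / x + y}.
Hypothesis gS : forall m s, g (ract m s) = ract (g m) s.
Hypothesis hS : forall s n, h (lact s n) = lact s (h n).

Let freeg_mapB x y : freeg_map (x - y) = freeg_map x - freeg_map y.
Proof. exact: lift_is_additive. Qed.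

Let freeg_mapU m n : freeg_map (m ** n) = g m ** h n.
Proof. by rewrite /freeg_map liftU scale1r. Qed.

Let freeg_map_rel x : tensor_rel x -> tensor_rel (freeg_map x).
Proof.
elim=> [m m' n|m n n'|m s n||{}x y _ rx _ ry].
- by rewrite !freeg_mapB !freeg_mapU gD; apply: TensorDl.
- by rewrite !freeg_mapB !freeg_mapU hD; apply: TensorDr.
- by rewrite !freeg_mapB !freeg_mapU gS hS; apply: TensorBal.
- by rewrite -(subrr 0) freeg_mapB subrr; apply: Tensor0.
- by rewrite freeg_mapB; apply: TensorB.
Qed.

Fact tensor_map_pi x : tensor_map (\pi_tensor x) = \pi_tensor (freeg_map x).
Proof.
apply: tensor_pi_eq; rewrite -freeg_mapB; apply/freeg_map_rel/tensor_pi_rel.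
exact: reprK.
Qed.

Fact tensor_mapB x y : tensor_map (x - y) = tensor_map x - tensor_map y.
Proof.
rewrite -[x]reprK -[y]reprK -tensor_piB !tensor_map_pi.
by rewrite freeg_mapB tensor_piB.
Qed.

Fact tensor_mapE m n : tensor_map (tpure m n) = tpure (g m) (h n).
Proof. by rewrite tensor_map_pi freeg_mapU. Qed.

End Endo.

Fact tpureDl m m' n : tpure (m + m') n = tpure m n + tpure m' n.
Proof.
apply/eqP; rewrite -subr_eq0 opprD addrA -!tensor_piB -tensor_pi0.
by apply/eqP/tensor_pi_eq; rewrite subr0; apply: TensorDl.
Qed.

Fact tpureDr m n n' : tpure m (n + n') = tpure m n + tpure m n'.
Proof.
apply/eqP; rewrite -subr_eq0 opprD addrA -!tensor_piB -tensor_pi0.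
by apply/eqP/tensor_pi_eq; rewrite subr0; apply: TensorDr.
Qed.

Fact tpure_balanced m s n : tpure (ract m s) n = tpure m (lact s n).
Proof. exact/tensor_pi_eq/TensorBal. Qed.

Definition tensor_lact (a : R) : tensor -> tensor := tensor_map (lact a) id.
Definition tensor_ract (t : tensor) (c : T) : tensor :=
  tensor_map id (fun n => ract n c) t.

Let tlactB a x y : tensor_lact a (x - y) = tensor_lact a x - tensor_lact a y.
Proof.
apply: tensor_mapB => //; first exact: lactDr.
by move=> x' s; rewrite lract.
Qed.
Let tractB x y c : tensor_ract (x - y) c = tensor_ract x c - tensor_ract y c.
Proof.
apply: tensor_mapB => //; first by move=> ? ?; apply: ractDl.
by move=> s x'; rewrite lract.
Qed.

Fact tensor_lactE a m n : tensor_lact a (tpure m n) = tpure (lact a m) n.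
Proof.
apply: tensor_mapE => //; first exact: lactDr.
by move=> x' s; rewrite lract.
Qed.
Fact tensor_ractE m n c : tensor_ract (tpure m n) c = tpure m (ract n c).
Proof.
apply: tensor_mapE => //; first by move=> ? ?; apply: ractDl.
by move=> s x'; rewrite lract.
Qed.

Let tlact0 a : tensor_lact a 0 = 0.
Proof. by have := tlactB a 0 0; rewrite !subrr. Qed.
Let tract0 c : tensor_ract 0 c = 0.
Proof. by have := tractB 0 0 c; rewrite !subrr. Qed.

Let tlactD a x y : tensor_lact a (x + y) = tensor_lact a x + tensor_lact a y.
Proof. by rewrite -{1}[y]opprK tlactB -[- y]sub0r tlactB tlact0 sub0r opprK. Qed.
Let tractD x y c : tensor_ract (x + y) c = tensor_ract x c + tensor_ract y c.
Proof. by rewrite -{1}[y]opprK tractB -[- y]sub0r tractB tract0 sub0r opprK. Qed.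

Let tlactA a b t : tensor_lact (a * b) t = tensor_lact a (tensor_lact b t).
Proof.
elim/tensor_ind: t => [|m n|x y IHx IHy]; first by rewrite !tlact0.
  by rewrite !tensor_lactE lactA.
by rewrite !tlactB IHx IHy.
Qed.

Let tlact1 t : tensor_lact 1 t = t.
Proof.
elim/tensor_ind: t => [|m n|x y IHx IHy]; first by rewrite !tlact0.
  by rewrite !tensor_lactE lact1.
by rewrite !tlactB IHx IHy.
Qed.

Let tlactDl a b t : tensor_lact (a + b) t = tensor_lact a t + tensor_lact b t.
Proof.
elim/tensor_ind: t => [|m n|x y IHx IHy]; first by rewrite !tlact0 addr0.
  by rewrite !tensor_lactE lactDl tpureDl.
by rewrite !tlactB IHx IHy opprD addrACA.
Qed.

Let tractA t c d : tensor_ract t (c * d) = tensor_ract (tensor_ract t c) d.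
Proof.
elim/tensor_ind: t => [|m n|x y IHx IHy]; first by rewrite !tract0.
  by rewrite !tensor_ractE ractA.
by rewrite !tractB IHx IHy.
Qed.

Let tract1 t : tensor_ract t 1 = t.
Proof.
elim/tensor_ind: t => [|m n|x y IHx IHy]; first by rewrite !tract0.
  by rewrite !tensor_ractE ract1.
by rewrite !tractB IHx IHy.
Qed.

Let tractDr t c d : tensor_ract t (c + d) = tensor_ract t c + tensor_ract t d.
Proof.
elim/tensor_ind: t => [|m n|x y IHx IHy]; first by rewrite !tract0 addr0.
  by rewrite !tensor_ractE ractDr tpureDr.
by rewrite !tractB IHx IHy opprD addrACA.
Qed.

Let tlract a t c :
  tensor_lact a (tensor_ract t c) = tensor_ract (tensor_lact a t) c.
Proof.
elim/tensor_ind: t => [|m n|x y IHx IHy].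
- by rewrite !(tlact0, tract0).
- by rewrite !(tensor_lactE, tensor_ractE).
- by rewrite !(tlactB, tractB) IHx IHy.
Qed.

HB.instance Definition _ := Zmodule_isBimodule.Build R T tensor
  tlactA tlact1 tlactD tlactDl tractA tract1 tractD tractDr tlract.

End Tensor.

(* A is unital, so every two-sided ideal of the ring A is a k-subspace. *)
Definition two_sided (k : fieldType) (A : falgType k) (I : {vspace A}) :=
  (fullv * I <= I)%VS && (I * fullv <= I)%VS.

Record ideal (k : fieldType) (A : falgType k) :=
  Ideal { ideal_space :> {vspace A}; idealP : two_sided ideal_space }.

Section IdealBimodule.
Variables (k : fieldType) (A : falgType k) (I : ideal A).

Fact ideal_mull (a : A) (x : A) : x \in (I : {vspace A}) -> a * x \in (I : {vspace A}).
Proof.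
have /andP[/subvP sI _] := idealP I.
by move=> Ix; apply/sI/memv_mul => //; apply: memvf.
Qed.

Fact ideal_mulr (a : A) (x : A) : x \in (I : {vspace A}) -> x * a \in (I : {vspace A}).
Proof.
have /andP[_ /subvP sI] := idealP I.
by move=> Ix; apply/sI/memv_mul => //; apply: memvf.
Qed.

Definition ideal_mod : Type := subvs_of I.
HB.instance Definition _ := Vector.on ideal_mod.

Definition ideal_lact (a : A) (x : ideal_mod) : ideal_mod :=
  Subvs (ideal_mull a (subvsP x)).
Definition ideal_ract (x : ideal_mod) (a : A) : ideal_mod :=
  Subvs (ideal_mulr a (subvsP x)).

Let ilactA a b x : ideal_lact (a * b) x = ideal_lact a (ideal_lact b x).
Proof. by apply: val_inj; rewrite /= mulrA. Qed.
Let ilact1 x : ideal_lact 1 x = x.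
Proof. by apply: val_inj; rewrite /= mul1r. Qed.
Let ilactDr a x y : ideal_lact a (x + y) = ideal_lact a x + ideal_lact a y.
Proof. by apply: val_inj; rewrite /= mulrDr. Qed.
Let ilactDl a b x : ideal_lact (a + b) x = ideal_lact a x + ideal_lact b x.
Proof. by apply: val_inj; rewrite /= mulrDl. Qed.
Let iractA x a b : ideal_ract x (a * b) = ideal_ract (ideal_ract x a) b.
Proof. by apply: val_inj; rewrite /= mulrA. Qed.
Let iract1 x : ideal_ract x 1 = x.
Proof. by apply: val_inj; rewrite /= mulr1. Qed.
Let iractDl x y a : ideal_ract (x + y) a = ideal_ract x a + ideal_ract y a.
Proof. by apply: val_inj; rewrite /= mulrDl. Qed.
Let iractDr x a b : ideal_ract x (a + b) = ideal_ract x a + ideal_ract x b.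
Proof. by apply: val_inj; rewrite /= mulrDr. Qed.
Let ilract a x b :
  ideal_lact a (ideal_ract x b) = ideal_ract (ideal_lact a x) b.
Proof. by apply: val_inj; rewrite /= mulrA. Qed.

HB.instance Definition _ := Zmodule_isBimodule.Build A A ideal_mod
  ilactA ilact1 ilactDr ilactDl iractA iract1 iractDl iractDr ilract.

(* Subbimodules of the bimodule I are the ideals of A contained in I. *)
Definition indecomposable : Prop :=
  (I : {vspace A}) <> 0%VS /\
  forall J1 J2 : ideal A, (J1 + J2 = I)%VS -> (J1 :&: J2 = 0)%VS ->
    J1 = 0%VS :> {vspace A} \/ J2 = 0%VS :> {vspace A}.

End IdealBimodule.

Fact two_sided_prod (k : fieldType) (A : falgType k) (I J : ideal A) :
  two_sided (I * J)%VS.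
Proof.
have /andP[sI _] := idealP I; have /andP[_ sJ] := idealP J.
by apply/andP; split; rewrite ?prodvA -?prodvA;
  [rewrite prodvA prodvSl | rewrite prodvSr].
Qed.

Definition ideal_prod (k : fieldType) (A : falgType k) (I J : ideal A) : ideal A :=
  Ideal (two_sided_prod I J).

Definition undirected (T : Type) (e : rel T) : rel T :=
  fun x y => e x y || e y x.

(* The underlying graph of a tree is simple, so an arrow is determined by its
   ends.  Once loops and opposite pairs of arrows are excluded, a cycle is a
   duplicate-free closed walk on at least three vertices. *)
Record oriented_tree (n : nat) := OrientedTree {
  arrow : rel 'I_n;
  tree_nonempty : (0 < n)%N;
  arrow_asym : forall i j, ~~ (arrow i j && arrow j i);
  tree_connected : forall i j, connect (undirected arrow) i j;
  tree_acyclic : forall c : seq 'I_n, (2 < size c)%N ->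
    ~~ ucycleb (undirected arrow) c
}.

Section OrientedTree.
Variables (n : nat) (Q : oriented_tree n).

Definition edge : rel 'I_n := undirected (arrow Q).

Definition degree (i : 'I_n) : nat := #|[set j | edge i j]|.

Definition is_source (i : 'I_n) : bool := [forall j, ~~ arrow Q j i].
Definition is_sink (i : 'I_n) : bool := [forall j, ~~ arrow Q i j].

Definition Kset : {set 'I_n} := [set i | is_sink i || is_source i].
Definition Kset' : {set 'I_n} := [set i in Kset | (2 <= degree i)%N].

Definition admissible : Prop := forall i, (3 <= degree i)%N -> i \in Kset.

(* A path is encoded by its first vertex and the sequence of the following ones;
   the paths of length 0 are the (i, [::]). *)
Record qpath := QPath { qp : 'I_n * seq 'I_n; _ : path (arrow Q) qp.1 qp.2 }.
HB.instance Definition _ := [isSub for qp].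
HB.instance Definition _ := [Countable of qpath by <:].

Definition source (p : qpath) : 'I_n := (qp p).1.
Definition steps (p : qpath) : seq 'I_n := (qp p).2.
Definition target (p : qpath) : 'I_n := last (source p) (steps p).

Definition is_concat (p q r : qpath) : bool :=
  [&& target p == source q, source r == source p & steps r == steps p ++ steps q].

Fact qpath_uniq (x : 'I_n) (s : seq 'I_n) : path (arrow Q) x s -> uniq (x :: s).
Proof.
elim: s x => // y s IH x /= /andP[xy ys]; have /= -> := IH _ ys.
rewrite andbT; apply/negP => xs.
have [s1 [s2 [defs Ns1]]] : exists s1 s2, y :: s = s1 ++ x :: s2 /\ x \notin s1.
  case/splitPr: xs (IH _ ys) => p1 p2 U; exists p1, p2; split=> //.
  move: U; rewrite cat_uniq => /and3P[_ U _]; apply: contra U => xp1.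
  by apply/hasP; exists x; rewrite ?inE ?eqxx.
have pc : path (arrow Q) x (y :: s) by rewrite /= xy.
rewrite defs cat_path /= in pc; case/and3P: pc => p1 lx _.
have Uc : uniq (x :: s1).
  rewrite /= Ns1; move: (IH _ ys); rewrite defs cat_uniq.
  by case/andP.
have cyc : cycle (arrow Q) (x :: s1) by rewrite /= rcons_path p1.
case: (ltnP 2 (size (x :: s1))) => [lt2|].
  have /negP := tree_acyclic Q lt2; apply; rewrite /ucycleb Uc andbT.
  by apply: sub_path cyc => a b ab; rewrite /undirected ab.
case: s1 {defs Ns1 Uc lx} p1 cyc => [_|z [|//]] /=.
  by rewrite andbT => xx; have := arrow_asym Q x x; rewrite xx.
by rewrite !andbT => _ + _; have := arrow_asym Q x z; move/negP.
Qed.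

Definition qpath_encode (p : qpath) : 'I_n * n.-bseq 'I_n :=
  (source p, insub_bseq n (steps p)).
Definition qpath_decode (c : 'I_n * n.-bseq 'I_n) : option qpath :=
  insub (c.1, c.2 : seq 'I_n).
Fact qpath_encodeK : pcancel qpath_encode qpath_decode.
Proof.
move=> [[x s] p]; rewrite /qpath_decode /qpath_encode /source /steps /=.
have ls : (size s <= n)%N.
  have /= /andP[_ /card_uniqP <-] := qpath_uniq p.
  by rewrite -[X in (_ <= X)%N]card_ord max_card.
have -> : (insub_bseq n s : seq _) = s by rewrite /insub_bseq val_insubd ls.
by rewrite insubT; congr Some; apply: val_inj.
Qed.
HB.instance Definition _ : isFinite qpath := PCanIsFinite qpath_encodeK.

Definition chain3 (p q s r : qpath) : bool :=
  [&& target p == source q, target q == source s, source r == source p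
    & steps r == steps p ++ steps q ++ steps s].

Fact card_chain3l p q s r :
  #|[pred u | is_concat p q u && is_concat u s r]| = chain3 p q s r.
Proof.
case: (boolP (chain3 p q s r)) => [|C]; last first.
  apply: eq_card0 => u; rewrite !inE; apply: contraNF C.
  move=> /andP[/and3P[pq /eqP up /eqP eu] /and3P[us ru /eqP er]].
  rewrite /chain3 pq er eu catA eqxx (eqP ru) up eqxx -(eqP us).
  by rewrite /target up eu last_cat -[last _ (steps p)]/(target p) (eqP pq) eqxx.
case: p q s r => [[p0 p] pP] [[q0 q] qP] [[s0 s] sP] [[r0 r] rP].
rewrite /chain3 /target /source /steps /= => /and4P[pq qs /eqP rp /eqP er].
have uP : path (arrow Q) p0 (p ++ q) by rewrite cat_path pP (eqP pq).
rewrite -(card1 (@QPath (p0, p ++ q) uP)); apply: eq_card => -[[u0 u] uP'].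
rewrite !inE -val_eqE /= xpair_eqE /is_concat /target /source /steps /= pq /=.
apply/idP/idP => [/andP[]//|/andP[/eqP u0p /eqP eu]]; subst u0 u r0.
by rewrite !eqxx er catA eqxx last_cat (eqP pq) qs.
Qed.

Fact card_chain3r p q s r :
  #|[pred u | is_concat q s u && is_concat p u r]| = chain3 p q s r.
Proof.
case: (boolP (chain3 p q s r)) => [|C]; last first.
  apply: eq_card0 => u; rewrite !inE; apply: contraNF C.
  move=> /andP[/and3P[qs /eqP uq /eqP eu] /and3P[pu rp /eqP er]].
  by rewrite /chain3 qs er eu eqxx rp -uq pu.
case: p q s r => [[p0 p] pP] [[q0 q] qP] [[s0 s] sP] [[r0 r] rP].
rewrite /chain3 /target /source /steps /= => /and4P[pq qs /eqP rp /eqP er].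
have uP : path (arrow Q) q0 (q ++ s) by rewrite cat_path qP (eqP qs).
rewrite -(card1 (@QPath (q0, q ++ s) uP)); apply: eq_card => -[[u0 u] uP'].
rewrite !inE -val_eqE /= xpair_eqE /is_concat /target /source /steps /= qs /=.
apply/idP/idP => [/andP[]//|/andP[/eqP u0q /eqP eu]]; subst u0 u r0.
by rewrite !eqxx er eqxx pq.
Qed.

End OrientedTree.

Section PathAlgebra.
Variables (k : fieldType) (n : nat) (Q : oriented_tree n).

(* A tree has finitely many paths, so a k-linear combination of paths is just a
   function on them; the product of the paths p and q is "p followed by q" if p
   ends where q starts, and 0 otherwise. *)
Definition pathalg : Type := {ffun qpath Q -> k^o}.
HB.instance Definition _ := Vector.on pathalg.

Implicit Types f g h : pathalg.

Definition pathalg_one : pathalg := [ffun p => (steps p == [::])%:R].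

Definition pathalg_mul f g : pathalg :=
  [ffun r => \sum_p \sum_(q | is_concat p q r) f p * g q].

Let mulE f g r :
  pathalg_mul f g r = \sum_p \sum_q (f p * g q) *+ is_concat p q r.
Proof.
rewrite ffunE; apply: eq_bigr => p _; rewrite big_mkcond.
by apply: eq_bigr => q _; rewrite mulrb.
Qed.

Let mulA : associative pathalg_mul.
Proof.
move=> f g h; apply/ffunP => r; rewrite !mulE.
pose F p q s := f p * g q * h s.
transitivity (\sum_p \sum_q \sum_s F p q s *+ chain3 p q s r).
  apply: eq_bigr => p _.
  transitivity (\sum_v \sum_q \sum_s
      F p q s *+ (is_concat q s v && is_concat p v r)).
    apply: eq_bigr => v _; rewrite mulE mulr_sumr -sumrMnl; apply: eq_bigr => q _.
    rewrite mulr_sumr -sumrMnl; apply: eq_bigr => s _.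
    by rewrite mulrnAr -mulrnA mulnb /F mulrA.
  rewrite exchange_big; apply: eq_bigr => q _ /=.
  rewrite exchange_big; apply: eq_bigr => s _ /=.
  rewrite -card_chain3r -sumr_const [RHS]big_mkcond; apply: eq_bigr => v _.
  by rewrite inE mulrb.
transitivity (\sum_u \sum_s \sum_p \sum_q
    F p q s *+ (is_concat p q u && is_concat u s r)); last first.
  apply: eq_bigr => u _; apply: eq_bigr => s _.
  rewrite mulE mulr_suml -sumrMnl; apply: eq_bigr => p _.
  rewrite mulr_suml -sumrMnl; apply: eq_bigr => q _.
  by rewrite mulrnAl -mulrnA mulnb.
under [RHS]eq_bigr => u _ do rewrite exchange_big.
rewrite [RHS]exchange_big; apply: eq_bigr => p _.
under [RHS]eq_bigr => u _ do rewrite exchange_big.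
rewrite [RHS]exchange_big; apply: eq_bigr => q _ /=.
rewrite [RHS]exchange_big; apply: eq_bigr => s _ /=.
rewrite -card_chain3l -sumr_const [LHS]big_mkcond; apply: eq_bigr => v _.
by rewrite inE mulrb.
Qed.

Let mul1 : left_id pathalg_one pathalg_mul.
Proof.
move=> f; apply/ffunP => r; rewrite mulE.
pose e : qpath Q := @QPath _ Q (source r, [::]) isT.
rewrite (bigD1 e) //= (bigD1 r) //= /pathalg_one !ffunE /is_concat !eqxx mul1r.
rewrite !big1 ?addr0 // => [p pe|q qr].
  apply: big1 => q _; rewrite ffunE mulrb /is_concat; case: ifP => // /and3P[_ rp er].
  case: eqP => [p0|]; last by rewrite mul0r.
  case/eqP: pe; apply: val_inj; rewrite /= (eqP rp).
  by move: p0; rewrite /source /steps; case: (qp p) => a b /= ->.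
rewrite mulrb /target /=; case: ifP => // /andP[rq er].
case/eqP: qr; apply: val_inj => /=; move: rq er; rewrite /source /steps.
by rewrite /= /source; case: (qp q) (qp r) => a b [c d] /= /eqP -> /eqP ->.
Qed.

Let mulr1 : right_id pathalg_one pathalg_mul.
Proof.
move=> f; apply/ffunP => r; rewrite mulE.
pose e : qpath Q := @QPath _ Q (target r, [::]) isT.
rewrite (bigD1 r) //= (bigD1 e) //= /pathalg_one !ffunE /is_concat cats0 !eqxx /= mulr1.
rewrite !big1 ?addr0 // => [p pr|q qe].
  apply: big1 => q _; rewrite ffunE mulrb; case: ifP => // /and3P[_ rp er].
  case: eqP => [q0|]; last by rewrite mulr0.
  case/eqP: pr; apply: val_inj => /=; move: rp er; rewrite q0 cats0 /source /steps.
  by case: (qp p) (qp r) => a b [c d] /= /eqP -> /eqP ->.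
rewrite ffunE mulrb; case: ifP => // /andP[rq er].
case: eqP => [q0|]; last by rewrite mulr0.
case/eqP: qe; apply: val_inj; rewrite /= (eqP rq).
by move: q0; rewrite /source /steps; case: (qp q) => a b /= ->.
Qed.

Let mulDl : left_distributive pathalg_mul +%R.
Proof.
move=> f g h; apply/ffunP => r; rewrite !ffunE -big_split; apply: eq_bigr => p _.
by rewrite -big_split; apply: eq_bigr => q _; rewrite !ffunE mulrDl.
Qed.

Let mulDr : right_distributive pathalg_mul +%R.
Proof.
move=> f g h; apply/ffunP => r; rewrite !ffunE -big_split; apply: eq_bigr => p _.
by rewrite -big_split; apply: eq_bigr => q _; rewrite !ffunE mulrDr.
Qed.

Let one_neq0 : pathalg_one != 0.
Proof.
pose e : qpath Q := @QPath _ Q (Ordinal (tree_nonempty Q), [::]) isT.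
apply/eqP => /ffunP/(_ e); rewrite !ffunE eqxx => /eqP.
by rewrite oner_eq0.
Qed.

HB.instance Definition _ := GRing.Zmodule_isNzRing.Build pathalg
  mulA mul1 mulr1 mulDl mulDr one_neq0.

Let scaleAl (a : k) f g : a *: (f * g) = a *: f * g.
Proof.
apply/ffunP => r; rewrite !ffunE scaler_sumr; apply: eq_bigr => p _.
rewrite scaler_sumr; apply: eq_bigr => q _.
by rewrite ffunE -scalerAl.
Qed.
HB.instance Definition _ := GRing.Lmodule_isLalgebra.Build k pathalg scaleAl.

Let scaleAr (a : k) f g : a *: (f * g) = f * (a *: g).
Proof.
apply/ffunP => r; rewrite !ffunE scaler_sumr; apply: eq_bigr => p _.
rewrite scaler_sumr; apply: eq_bigr => q _.
by rewrite ffunE -scalerAr.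
Qed.
HB.instance Definition _ := GRing.Lalgebra_isAlgebra.Build k pathalg scaleAr.
HB.instance Definition _ := Algebra_isFalgebra.Build k pathalg.

End PathAlgebra.

(* Main.v *)
Require Import Defs.
From HB Require Import structures.
From mathcomp Require Import all_boot all_order all_algebra all_field.
From mathcomp Require Import boolp.
From mathcomp.multinomials Require Import freeg.

Set Implicit Arguments.
Unset Strict Implicit.
Unset Printing Implicit Defensive.

Import GRing.Theory.
Local Open Scope ring_scope.

(* In a tree a path is determined by its ends, so an ideal is spanned by the
   paths it contains, and these form an up-set for the subpath order.

   If pq = r = p'q' with p, p' in B and q, q' in D, then p (x) q = p' (x) q',
   because the segment of r between the two cuts moves across the tensor sign.
   Hence B (x) D is spanned by one element for each path in BD, and the
   multiplication map is an isomorphism, for arbitrary ideals B and D.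

   Call I one-sided if for each sink or source i with e_i not in I all the paths
   of I lie in the same branch of Q at i.  An indecomposable ideal is one-sided,
   since otherwise the branches at i split it.  Conversely, suppose that
   I = J1 + J2 is direct and one-sided.  Walk in the tree from a path of J1 to a
   path of J2.  At a vertex which is neither a sink nor a source only one
   direction is possible, so paths of J1 extend along the walk; at a sink or
   source i either e_i is in J1 or one-sidedness forces the path of J1 to go in
   the direction of the walk.  In the end J1 and J2 share a path, which is
   absurd.  If B and D are one-sided, so is BD: if e_i = e_i e_i is not in BD, it
   is missing from B or from D, and BD is contained in both. *)

(** On [D] each vertex has at most one successor, so two walks from [x] take the same steps until
    one of them stops. *)
Lemma connect_comparable (T : finType) (e : rel T) (D : {pred T}) x y z :
  (forall a b, a \in D -> e a b -> b \in D) ->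
  (forall a b c, a \in D -> e a b -> e a c -> b = c) ->
  x \in D -> connect e x y -> connect e x z -> connect e y z || connect e z y.
Proof.
move=> De fe + /connectP[p + ->] /connectP[q + ->].
elim: p x q => [|a p IH] x q Dx xp xq.
  by apply/orP; left; apply/connectP; exists q.
case: q xq => [_|b q] /=.
  by apply/orP; right; apply/connectP; exists (a :: p).
move: xp => /=.
move=> /andP[xa ap] /andP[xb]; rewrite -(fe x a b) // => bq.
by apply: IH => //; apply: De xa.
Qed.

(** * Paths in an admissible tree *)

Section Tree.
Variables (n : nat) (Q : oriented_tree n).
Implicit Types (x y z i a b : 'I_n) (p q r : qpath Q).

Local Notation reach := (connect (arrow Q)).

(** For vertices other than [i], [conn_off i] means lying in the same branch of the tree at [i]. It
    is reflexive at [i] too, whence the side conditions [x != i] below. *)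
Definition edge_off i : rel 'I_n := [rel x y | [&& edge Q x y, x != i & y != i]].
Definition conn_off i := connect (edge_off i).

Lemma edge_sym : symmetric (edge Q).
Proof. by move=> x y; rewrite /edge /undirected orbC. Qed.

Lemma edge_neq x y : edge Q x y -> x != y.
Proof.
case/orP; apply: contraTneq => ->;
  by have := arrow_asym Q y y; rewrite andbb.
Qed.

Lemma conn_off_sym i : symmetric (conn_off i).
Proof.
apply: sym_connect_sym => x y.
by rewrite /edge_off /= edge_sym (andbC (x != i)).
Qed.

(** Otherwise a walk from [a] to [b] off [i], shortened to be duplicate-free, would close up through
    [i] to a cycle. *)
Lemma conn_off_nbr i a b :
  edge Q i a -> edge Q i b -> conn_off i a b -> a = b.
Proof.
move=> ia ib /connectP[p0 pP0 lp]; apply/eqP; apply: contraT => nab.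
move: lp nab ib; case/shortenP: pP0 => [[|c p] + U _ -> nab ib]; first by rewrite eqxx in nab.
set s := c :: p => pP.
have offP : all (predC1 i) (a :: s).
  move: pP; rewrite {}/s /= => /andP[/and3P[_ -> ->]] /=.
  elim: p c {U nab ib} => //= d p IH c /andP[/and3P[_ _ ->]]; exact: IH.
have /negP[] := @tree_acyclic _ Q (i :: a :: s) isT.
rewrite /ucycleb cons_uniq U andbT; apply/andP; split; last first.
  by apply/negP => /(allP offP); rewrite /= eqxx.
have ps : path (edge Q) a s by apply: sub_path pP => ? ? /and3P[].
have lsi : edge Q (last a s) i by rewrite edge_sym.
by move: (rcons_path (edge Q) a s i); rewrite ps lsi /= -/(edge Q) ia => ->.
Qed.

Lemma path_conn_off i x s :
  path (edge Q) x s -> i \notin x :: s -> conn_off i x (last x s).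
Proof.
elim: s x => [|y s IH] x; first by rewrite /conn_off connect0.
rewrite /= inE negb_or eq_sym => /andP[xy ys] /andP[xi yi].
apply: connect_trans (IH _ ys yi); apply: connect1.
by rewrite /edge_off /= xy xi; move: yi; rewrite inE negb_or eq_sym => /andP[].
Qed.

Lemma arrow_path_edge x s : path (arrow Q) x s -> path (edge Q) x s.
Proof. by apply: sub_path => a b ab; rewrite /edge /undirected ab. Qed.

(** A directed path never returns to [x], so the first steps of both paths are neighbours of [x]
    joined off [x] through the common end; by [conn_off_nbr] they agree. *)
Lemma arrow_path_inj x s t :
  path (arrow Q) x s -> path (arrow Q) x t -> last x s = last x t -> s = t.
Proof.
elim: s x t => [|a s IH] x [|b t] // xs xt.
- by move=> /= e; have /andP[] := qpath_uniq xt; rewrite {1}e mem_last.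
- by move=> /= e; have /andP[] := qpath_uniq xs; rewrite -{1}e mem_last.
have /andP[xas _] := qpath_uniq xs; have /andP[xbt _] := qpath_uniq xt.
move: xs xt => /= /andP[xa as_] /andP[xb bt] e.
have ab : a = b.
  apply: (@conn_off_nbr x); rewrite /edge /undirected ?xa ?xb //.
  apply: (@connect_trans _ _ (last a s)).
    exact/path_conn_off/xas/arrow_path_edge.
  by rewrite e -/(conn_off _ _ _) conn_off_sym; apply/path_conn_off/xbt/arrow_path_edge.
by rewrite -ab in bt e *; rewrite (IH _ _ as_ bt e).
Qed.

Lemma reach_antisym x y : reach x y -> reach y x -> x = y.
Proof.
move=> /connectP[s xs ->] /connectP[t yt e].
have := @arrow_path_inj x (s ++ t) [::]; rewrite cat_path xs yt last_cat -e.
by case: s {e yt xs} => // a s /(_ isT isT erefl).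
Qed.

Lemma KsetP i a b : i \in Kset Q -> arrow Q a i -> ~~ arrow Q i b.
Proof.
rewrite inE => /orP[/forallP/(_ b)//|/forallP/(_ a)/negP//].
Qed.

(** A directed path can meet a sink or a source only at its ends. *)
Lemma reach_conn_off i x y :
  i \in Kset Q -> reach x y -> x != i -> y != i -> conn_off i x y.
Proof.
move=> Ki /connectP[s + ->].
elim: s x => [|a s IH] x /=; first by rewrite /conn_off connect0.
case/andP=> xa as_ xi li; have [ai|ai] := eqVneq a i; last first.
  apply: connect_trans (IH _ as_ ai li); apply: connect1.
  by rewrite /edge_off /= /edge /undirected xa xi ai.
move: as_ li; rewrite ai in xa *; case: s {IH} => [|b s /=]; first by rewrite eqxx.
by rewrite (negbTE (KsetP b Ki xa)).
Qed.

(** * Admissibility: directed walks do not branch away from sinks and sources *)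

Lemma arrow_neq x a c : arrow Q c x -> arrow Q x a -> a != c.
Proof.
by move=> cx; apply: contraTneq => ->; have := arrow_asym Q c x; rewrite cx.
Qed.

(** Three distinct neighbours would give degree at least 3, and admissibility would put [x] in
    [Kset]. *)
Lemma nbr_inj (hQ : admissible Q) x a b c : x \notin Kset Q ->
  edge Q x a -> edge Q x b -> edge Q x c -> a != c -> b != c -> a = b.
Proof.
move=> Kx xa xb xc ac bc; apply/eqP; apply: contraNT Kx => ab.
apply: hQ; have <- : #|[set a; b; c]| = 3%N.
  by rewrite setUC cardsU1 cards2 ab !inE negb_or ![c == _]eq_sym ac bc.
apply/subset_leq_card/subsetP => d; rewrite !inE.
by case/orP=> [/orP[]|] /eqP->.
Qed.

Lemma arrow_out_inj (hQ : admissible Q) x a b :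
  ~~ is_source Q x -> arrow Q x a -> arrow Q x b -> a = b.
Proof.
move=> /forallPn[c]; rewrite negbK => cx xa xb; apply: (@nbr_inj hQ x _ _ c).
- by apply: contraL xa => Kx; apply: KsetP cx.
- by rewrite /edge /undirected xa.
- by rewrite /edge /undirected xb.
- by rewrite /edge /undirected cx orbT.
- exact: arrow_neq xa.
- exact: arrow_neq xb.
Qed.

Lemma arrow_in_inj (hQ : admissible Q) x a b :
  ~~ is_sink Q x -> arrow Q a x -> arrow Q b x -> a = b.
Proof.
move=> /forallPn[c]; rewrite negbK => xc ax bx; apply: (@nbr_inj hQ x _ _ c).
- by apply: contraL xc => Kx; apply: KsetP ax.
- by rewrite /edge /undirected ax orbT.
- by rewrite /edge /undirected bx orbT.
- by rewrite /edge /undirected xc.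
- by rewrite eq_sym (arrow_neq ax).
- by rewrite eq_sym (arrow_neq bx).
Qed.

(** No vertex reachable from a non-source is a source, so each of them has at most one outgoing
    arrow. *)
Lemma reach_comparable_above (hQ : admissible Q) x y z :
  ~~ is_source Q x -> reach x y -> reach x z -> reach y z || reach z y.
Proof.
apply: (@connect_comparable _ _ [pred a | ~~ is_source Q a]) => [a b _ ab|a b c].
  by apply/forallPn; exists a; rewrite negbK.
exact: arrow_out_inj.
Qed.

Lemma reach_comparable_below (hQ : admissible Q) x y z :
  ~~ is_sink Q x -> reach y x -> reach z x -> reach y z || reach z y.
Proof.
move=> Kx; rewrite -[reach y x]connect_rev -[reach z x]connect_rev.
move=> xy xz; rewrite orbC -[reach z y]connect_rev -[reach y z]connect_rev.
apply: (@connect_comparable _ _ [pred a | ~~ is_sink Q a]) Kx xy xz => [a b _ ab|a b c].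
  by apply/forallPn; exists a; rewrite negbK.
exact: arrow_in_inj.
Qed.

(** * The subpath order *)

Definition on_path p x := reach (source p) x && reach x (target p).
(** Since a path is determined by its ends, reachability between ends can replace containment of
    vertex sequences, here and in [on_path]. *)
Definition subpath p r := reach (source r) (source p) && reach (target p) (target r).

Lemma subpath_on_path p r x : subpath p r -> on_path p x -> on_path r x.
Proof.
move=> /andP[rp pr] /andP[px xp].
by rewrite /on_path (connect_trans rp px) (connect_trans xp pr).
Qed.

Definition idpath x : qpath Q := @QPath n Q (x, [::]) isT.

Lemma reach_qpath x y : reach x y -> exists2 p : qpath Q, source p = x & target p = y.
Proof. by move=> /connectP[s xs ->]; exists (@QPath n Q (x, s) xs). Qed.

Lemma qpath_reach p : reach (source p) (target p).
Proof. by case: p => -[x s] xs; apply/connectP; exists s. Qed.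

Lemma qpath_ends_inj p q :
  source p = source q -> target p = target q -> p = q.
Proof.
case: p q => [[x s] xs] [[y t] yt]; rewrite /target /source /steps /=.
move=> exy; subst y => e; apply: val_inj => /=.
by congr (_, _); apply: arrow_path_inj xs yt e.
Qed.

Lemma is_concat_ends p q r : is_concat p q r ->
  [/\ target p = source q, source r = source p & target r = target q].
Proof.
case/and3P=> /eqP pq /eqP rp /eqP e; split=> //.
by rewrite /target rp e last_cat -[last _ (steps p)]/(target p) pq.
Qed.

Lemma ends_is_concat p q r :
  target p = source q -> source r = source p -> target r = target q ->
  is_concat p q r.
Proof.
move=> pq rp rq; rewrite /is_concat pq rp !eqxx /=.
case: p q r pq rp rq => [[x s] xs] [[y t] yt] [[z u] zu].
rewrite /target /source /steps /= => e1 e2 e3; subst y z.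
by apply/eqP/(arrow_path_inj zu); rewrite ?cat_path ?xs //= last_cat.
Qed.

Lemma is_concat_exists p q : target p = source q -> exists r, is_concat p q r.
Proof.
move=> pq; have /reach_qpath[r sr tr] : reach (source p) (target q).
  by apply: connect_trans (qpath_reach p) _; rewrite pq qpath_reach.
by exists r; apply: ends_is_concat.
Qed.

Lemma subpath_concat p r : subpath p r ->
  exists u v w, is_concat u p w /\ is_concat w v r.
Proof.
move=> /andP[/reach_qpath[u us ut] /reach_qpath[v vs vt]].
have [w upw] := is_concat_exists ut; have [_ wu wp] := is_concat_ends upw.
by exists u, v, w; split=> //; apply: ends_is_concat; congruence.
Qed.

Lemma concat_subl p q r : is_concat p q r -> subpath p r.
Proof.
by case/is_concat_ends=> pq rp rq; rewrite /subpath rp connect0 rq pq qpath_reach.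
Qed.

Lemma concat_subr p q r : is_concat p q r -> subpath q r.
Proof.
by case/is_concat_ends=> pq rp rq; rewrite /subpath rp rq connect0 -pq qpath_reach.
Qed.

(** The two ends of [p] are not both [i], as antisymmetry would then give [x = i]. An end other than
    [i] joins [x] to [y]. *)
Lemma on_path_conn_off i p x y : i \in Kset Q ->
  on_path p x -> on_path p y -> x != i -> y != i -> conn_off i x y.
Proof.
move=> Ki /andP[px xp] /andP[py yp] xi yi.
have [ti|ti] := eqVneq (target p) i; last first.
  apply: connect_trans (reach_conn_off Ki xp xi ti) _.
  by rewrite -/(conn_off _ _ _) conn_off_sym; apply: reach_conn_off.
have si : source p != i.
  apply: contra xi => /eqP si; apply/eqP/reach_antisym; first by rewrite -ti.
  by rewrite -si.
apply: (connect_trans _ (reach_conn_off Ki py si yi)).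
by rewrite -/(conn_off _ _ _) conn_off_sym; apply: reach_conn_off.
Qed.

Lemma reach_step x y : reach x y -> x != y -> exists2 a, arrow Q x a & reach a y.
Proof.
case/connectP=> -[|a s] /= => [_ -> /eqP[]//|/andP[xa as_] -> _].
by exists a => //; apply/connectP; exists s.
Qed.

Lemma reach_step_last x y :
  reach x y -> x != y -> exists2 a, arrow Q a y & reach x a.
Proof.
case/connectP=> s; elim/last_ind: s => [|s a _] /=; first by move=> _ -> /eqP[].
rewrite rcons_path last_rcons => /andP[xs sa] -> _.
by exists (last x s) => //; apply/connectP; exists s.
Qed.

Lemma on_path_nbr p x : on_path p x -> p != idpath x -> exists2 a, edge Q x a & on_path p a.
Proof.
move=> /andP[px xp] pN; have [xt|/(reach_step xp)[a xa at_]] := eqVneq x (target p).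
  have [sx|/(reach_step_last px)[a ax sa]] := eqVneq (source p) x.
    by case/eqP: pN; apply: qpath_ends_inj.
  exists a; first by rewrite /edge /undirected ax orbT.
  by rewrite /on_path sa (connect_trans _ xp) ?connect1.
exists a; first by rewrite /edge /undirected xa.
by rewrite /on_path at_ (connect_trans px) ?connect1.
Qed.

Lemma edge_on_path x y : edge Q x y -> exists2 p, on_path p x & on_path p y.
Proof.
case/orP=> /connect1 /reach_qpath[p <- <-]; exists p;
  by rewrite /on_path ?connect0 ?qpath_reach.
Qed.

Lemma arrow_not_source x a : arrow Q x a -> ~~ is_source Q a.
Proof. by move=> xa; apply/forallPn; exists x; rewrite negbK. Qed.

Lemma arrow_not_sink x a : arrow Q x a -> ~~ is_sink Q x.
Proof. by move=> xa; apply/forallPn; exists a; rewrite negbK. Qed.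

(** The sources of [p] and [q] are comparable below [x] and their targets above [y]; [r] runs from
    the earlier source to the later target. *)
Lemma subpath_join (hQ : admissible Q) p q x y : ~~ is_sink Q x -> ~~ is_source Q y ->
  on_path p x -> on_path q x -> on_path p y -> on_path q y -> exists2 r, subpath p r & subpath q r.
Proof.
move=> Kx Ky /andP[px _] /andP[qx _] /andP[_ yp] /andP[_ yq].
have [s sp sq] : exists2 s, reach s (source p) & reach s (source q).
  by case/orP: (reach_comparable_below hQ Kx px qx);
    [exists (source p)|exists (source q)].
have [t pt qt] : exists2 t, reach (target p) t & reach (target q) t.
  by case/orP: (reach_comparable_above hQ Ky yp yq);
    [exists (target q)|exists (target p)].
have /reach_qpath[r rs rt] : reach s t.
  exact: connect_trans sp (connect_trans (qpath_reach p) pt).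
by exists r; rewrite /subpath rs rt ?sp ?sq.
Qed.

Lemma subpath_refl p : subpath p p.
Proof. by rewrite /subpath !connect0. Qed.

(** Along the arrow between [x] and [y] only one continuation exists, so either [p] already passes
    through [y] or it can be prolonged to [y]. *)
Lemma on_path_extend (hQ : admissible Q) p x y : x \notin Kset Q ->
  on_path p x -> edge Q x y -> exists2 r, subpath p r & on_path r y.
Proof.
rewrite inE negb_or => /andP[xsi xso] /andP[px xp].
case/orP=> /connect1 => [xy|yx].
  have := reach_comparable_above hQ xso xp xy.
  case/orP=> h; last by exists p; rewrite ?subpath_refl // /on_path h (connect_trans px).
  have /reach_qpath[r rs rt] := connect_trans px xy.
  by exists r; rewrite /subpath /on_path rs rt !connect0 ?h ?(connect_trans px xy).
have := reach_comparable_below hQ xsi px yx.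
case/orP=> h; first by exists p; rewrite ?subpath_refl // /on_path h (connect_trans yx).
have /reach_qpath[r rs rt] := connect_trans yx xp.
by exists r; rewrite /subpath /on_path rs rt !connect0 ?h ?(connect_trans yx xp).
Qed.

(** * Up-sets of paths and one-sidedness *)

Definition up_closed (U : {pred qpath Q}) := forall p r, p \in U -> subpath p r -> r \in U.

(* Off a sink or source that is itself absent from [U] as a trivial path, all of
   [U] lives in a single branch of the tree.  Among the nonzero ideals this
   singles out the indecomposable ones, and it visibly passes to products. *)
Definition one_sided (U : {pred qpath Q}) := forall i, i \in Kset Q ->
  idpath i \notin U -> forall p q x y, p \in U -> q \in U -> on_path p x -> on_path q y ->
  x != i -> y != i -> conn_off i x y.

Lemma up_closed_meet (hQ : admissible Q) (U V : {pred qpath Q}) p q :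
  up_closed U -> up_closed V -> one_sided [predU U & V] ->
  p \in U -> q \in V -> exists2 r, r \in U & r \in V.
Proof.
move=> upU upV UV Up Vq; apply: contrapT => disj.
have {}disj r : r \in U -> r \in V -> False by move=> Ur Vr; case: disj; exists r.
suff walk s x : path (edge Q) x s -> uniq (x :: s) ->
    (exists2 p, p \in U & on_path p x) -> (exists2 q, q \in V & on_path q (last x s)) -> False.
  have /connectP[s xs ls] := tree_connected Q (source p) (source q).
  case/shortenP: xs ls => t xt Ut _ ls.
  apply: (walk t (source p)) => //; first by exists p; rewrite // /on_path connect0 qpath_reach.
  by exists q; rewrite // -ls /on_path connect0 qpath_reach.
(* Along an undirected walk from U to V, membership in U propagates: through a
   vertex x off Kset since paths extend, and through x in Kset since either the
   trivial path at x is in U, or all paths leave x in the direction of V. *)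
move=> {p q Up Vq}; elim: s x => [|y s IH] x.
  move=> _ _ [p Up px] [q Vq /= qx].
  (* The walk has shrunk to [x]. Off [Kset] the vertex [x] serves as both [a] and [b]; in [Kset] the
     paths must share an edge at [x], whose two ends serve. *)
  suff [a [b [Ka Kb [pa qa pb qb]]]] : exists a b, [/\ ~~ is_sink Q a, ~~ is_source Q b
      & [/\ on_path p a, on_path q a, on_path p b & on_path q b]].
    have [r pr qr] := subpath_join hQ Ka Kb pa qa pb qb.
    exact: disj (upU _ _ Up pr) (upV _ _ Vq qr).
  have [Kx|] := boolP (x \in Kset Q); last first.
    by rewrite inE negb_or => /andP[? ?]; exists x, x.
  have [/orP[Ux|Vx]|xUV] := boolP (idpath x \in [predU U & V]).
  (* [on_path q x] unfolds to [subpath (idpath x) q]. *)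
  - by case: (disj q); first exact: upU Ux qx.
  - by case: (disj p); last exact: upV Vx px.
  have pUV : p \in [predU U & V] by rewrite inE Up.
  have qUV : q \in [predU U & V] by rewrite inE Vq orbT.
  have [|a xa pa] := on_path_nbr px; first by apply: contraNneq xUV => <-.
  have [|b xb qb] := on_path_nbr qx; first by apply: contraNneq xUV => <-.
  have ab : a = b.
    apply: (conn_off_nbr xa xb); apply: (UV x) (pa) (qb) _ _ => //;
    by rewrite eq_sym edge_neq.
  rewrite -{b}ab in qb {xb}; case/orP: xa => xa.
    by exists x, a; rewrite (arrow_not_source xa) (arrow_not_sink xa).
  by exists a, x; rewrite (arrow_not_source xa) (arrow_not_sink xa).
rewrite /= -/(edge Q) => /andP[xy ys] /andP[xys Uys] [p Up px] qex.
apply: (IH y) => // {IH}.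
have [Kx|Kx] := boolP (x \in Kset Q); last first.
  by have [r pr ry] := on_path_extend hQ Kx px xy; exists r => //; apply: upU pr.
have [/orP[Ux|Vx]|xUV] := boolP (idpath x \in [predU U & V]).
- by have [r rx ry] := edge_on_path xy; exists r => //; apply: upU Ux rx.
- by case: (disj p); last exact: upV Vx px.
have pUV : p \in [predU U & V] by rewrite inE Up.
have [|a xa pa] := on_path_nbr px; first by apply: contraNneq xUV => <-.
have [q Vq ql] := qex.
have qUV : q \in [predU U & V] by rewrite inE Vq orbT.
(* Both [a] and [y] lie in the branch at [x] of the end of the walk: [a] by one-sidedness, [y]
   because the rest of the walk avoids [x]. *)
suff <- : a = y by exists p.
apply: (conn_off_nbr xa xy).
have lx : last y s != x by apply: contraNneq xys => <-; apply: mem_last.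
apply: connect_trans (UV x Kx xUV p q _ _ pUV qUV pa ql _ lx) _.
  by rewrite eq_sym edge_neq.
by rewrite -/(conn_off _ _ _) conn_off_sym; apply: path_conn_off.
Qed.

End Tree.

(** * Ideals of the path algebra *)

Section PathAlgebraIdeals.
Variables (k : fieldType) (n : nat) (Q : oriented_tree n).
Local Notation A := (pathalg k Q).
Implicit Types (f g : A) (p q r : qpath Q) (I J : ideal A).

Lemma pathalg_mulE f g r :
  (f * g) r = \sum_p \sum_(q | is_concat p q r) f p * g q.
Proof. exact: ffunE. Qed.

Definition delta p : A := [ffun r => (r == p)%:R].

Lemma pathalgE f : f = \sum_p f p *: delta p.
Proof.
apply/ffunP => r; rewrite sum_ffunE (bigD1 r) //= !ffunE eqxx.
rewrite big1 ?addr0 => [|p /negbTE pr]; first by rewrite [_ *: _]mulr1.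
by rewrite !ffunE eq_sym pr [_ *: _]mulr0.
Qed.

Lemma delta_mulE p q r : (delta p * delta q) r = (is_concat p q r)%:R.
Proof.
rewrite pathalg_mulE (bigD1 p) //= [X in _ + X]big1 ?addr0; last first.
  by move=> u /negbTE up; apply: big1 => v _; rewrite ffunE up mul0r.
rewrite big_mkcond (bigD1 q) //= [X in _ + X]big1 ?addr0; last first.
  by move=> v /negbTE vq; rewrite [delta q v]ffunE vq mulr0 if_same.
by rewrite !ffunE !eqxx mulr1; case: ifP.
Qed.

Lemma delta_concat p q r : is_concat p q r -> delta p * delta q = delta r.
Proof.
move=> pqr; apply/ffunP => u; rewrite delta_mulE ffunE; congr (_%:R); congr nat_of_bool.
have [pq rp rq] := is_concat_ends pqr; apply/idP/eqP => [/is_concat_ends[_ up uq]|->//].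
by apply: qpath_ends_inj; congruence.
Qed.

Lemma delta_mul_neq p q : target p != source q -> delta p * delta q = 0.
Proof. by move=> /negbTE pq; apply/ffunP => u; rewrite delta_mulE ffunE /is_concat pq. Qed.

Lemma delta_idl x p : delta (idpath Q x) * delta p = if x == source p then delta p else 0.
Proof.
case: eqP => [->|/eqP xp]; last exact: delta_mul_neq.
by apply/delta_concat/ends_is_concat.
Qed.

Lemma delta_idr x p : delta p * delta (idpath Q x) = if target p == x then delta p else 0.
Proof.
case: eqP => [<-|/eqP xp]; last exact: delta_mul_neq.
by apply/delta_concat/ends_is_concat.
Qed.

(** Only [p] has both its ends, so multiplying by trivial paths isolates its term. This is why an
    ideal is spanned by paths. *)
Lemma delta_corner f p :
  delta (idpath Q (source p)) * f * delta (idpath Q (target p)) = f p *: delta p.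
Proof.
rewrite {1}[f]pathalgE mulr_sumr mulr_suml (bigD1 p) //= big1 ?addr0.
  by rewrite -scalerAr -scalerAl delta_idl eqxx delta_idr eqxx.
move=> q qp; rewrite -scalerAr -scalerAl delta_idl.
case: eqP => [pq|_]; last by rewrite mul0r scaler0.
rewrite delta_idr; case: eqP => [tq|_]; last by rewrite scaler0.
by case/eqP: qp; apply: qpath_ends_inj.
Qed.

Definition supp (I : {vspace A}) : {pred qpath Q} := fun p => delta p \in I.

Lemma supp_coef I f p : f \in (I : {vspace A}) -> f p != 0 -> p \in supp I.
Proof.
move=> If fp; rewrite unfold_in -[delta p](scalerK fp) memvZ // -delta_corner.
by rewrite ideal_mulr // ideal_mull.
Qed.

Lemma supp_up I : up_closed (supp I).
Proof.
move=> p r Ip /subpath_concat[u [v [w [uw wr]]]].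
by rewrite unfold_in -(delta_concat wr) -(delta_concat uw) ideal_mulr // ideal_mull.
Qed.

Lemma supp_eq0 I : (forall p, p \notin supp I) -> (I : {vspace A}) = 0%VS.
Proof.
move=> I0; apply/eqP; rewrite -subv0; apply/subvP => f If; rewrite memv0.
apply/eqP; rewrite [f]pathalgE big1 // => p _.
by have [->|/(supp_coef If)] := eqVneq (f p) 0; rewrite ?scale0r // (negbTE (I0 p)).
Qed.

Lemma delta_neq0 p : delta p != 0.
Proof. by apply/eqP => /ffunP/(_ p); rewrite !ffunE eqxx => /eqP; rewrite oner_eq0. Qed.

Definition span_paths (U : {pred qpath Q}) : {vspace A} := (\sum_(p in U) <[delta p]>)%VS.

Lemma span_pathsP (U : {pred qpath Q}) f :
  reflect (forall p, f p != 0 -> p \in U) (f \in span_paths U).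
Proof.
apply: (iffP memv_sumP) => [[g gU ->] p|fU].
  apply: contraNT => pU; rewrite sum_ffunE big1 // => q qU.
  have /vlineP[c ->] := gU q qU; rewrite !ffunE.
  by have [pq|_] := eqVneq p q; [rewrite pq qU in pU | rewrite [_ *: _]mulr0].
exists (fun p => f p *: delta p) => [p _|]; first by rewrite memvZ ?memv_line.
rewrite {1}[f]pathalgE [RHS]big_mkcond; apply: eq_bigr => p _.
by case: ifP => // /negbT /(contraNeq (fU p)) ->; rewrite scale0r.
Qed.

(** A path with nonzero coefficient in a product contains a path with nonzero coefficient in either
    given factor. *)
Lemma span_paths_two_sided (U : {pred qpath Q}) : up_closed U -> two_sided (span_paths U).
Proof.
move=> upU; apply/andP; split; apply/prodvP => f g.
  move=> _ /span_pathsP gU; apply/span_pathsP => r.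
  apply: contraNT => rU; rewrite pathalg_mulE big1 // => p _; apply: big1 => q pqr.
  have [->|gq] := eqVneq (g q) 0; first by rewrite mulr0.
  by case/negP: rU; apply: upU (gU q gq) (concat_subr pqr).
move=> /span_pathsP fU _; apply/span_pathsP => r.
apply: contraNT => rU; rewrite pathalg_mulE big1 // => p _; apply: big1 => q pqr.
have [->|fp] := eqVneq (f p) 0; first by rewrite mul0r.
by case/negP: rU; apply: upU (fU p fp) (concat_subl pqr).
Qed.

Lemma supp_span_paths (U : {pred qpath Q}) p : (p \in supp (span_paths U)) = (p \in U).
Proof.
apply/span_pathsP/idP => [/(_ p)|pU q]; rewrite ffunE; first by rewrite eqxx oner_eq0 => ->.
by case: (q =P p) => [->//|_]; rewrite eqxx.
Qed.

(** * Indecomposability and one-sidedness *)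

Lemma indecomposable_one_sided I : indecomposable I -> one_sided (supp I).
Proof.
move=> [_ indI] i Ki eI p q x y Ip Iq px qy xi yi.
(* The paths of I meeting the branch of x, and the others, span two ideals. *)
pose near : pred (qpath Q) := fun r => [exists z, [&& on_path r z, z != i & conn_off Q i x z]].
pose U1 : {pred qpath Q} := fun r => (r \in supp I) && near r.
pose U2 : {pred qpath Q} := fun r => (r \in supp I) && ~~ near r.
have near_all r z : near r -> on_path r z -> z != i -> conn_off Q i x z.
  case/existsP=> w /and3P[rw wi xw] rz zi.
  exact: connect_trans xw (on_path_conn_off Ki rw rz wi zi).
have up1 : up_closed U1.
  move=> r s /andP[Ir /existsP[z /and3P[rz zi xz]]] rs.
  apply/andP; split; first exact: supp_up Ir rs.
  by apply/existsP; exists z; rewrite (subpath_on_path rs rz) zi.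
have up2 : up_closed U2.
  move=> r s /andP[Ir Nr] rs.
  apply/andP; split; first exact: supp_up Ir rs.
  (* A path of [I] is not the trivial path at [i], so it has an end [z] other than [i], which fixes
     the branch of both [r] and [s]. *)
  have [z rz zi] : exists2 z, on_path r z & z != i.
    have [si|si] := eqVneq (source r) i; last first.
      by exists (source r); rewrite // /on_path connect0 qpath_reach.
    have [ti|ti] := eqVneq (target r) i; last first.
      by exists (target r); rewrite // /on_path connect0 qpath_reach.
    by case/negP: eI; rewrite (_ : idpath Q i = r) //; apply: qpath_ends_inj.
  apply: contra Nr => /near_all xN; apply/existsP; exists z.
  by rewrite rz zi xN // (subpath_on_path rs).
pose J1 := Ideal (span_paths_two_sided up1); pose J2 := Ideal (span_paths_two_sided up2).
have pJ1 : p \in U1.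
  by apply/andP; split=> //; apply/existsP; exists x; rewrite px xi /conn_off connect0.
have [||J10|J20] := indI J1 J2.
- apply/eqP; rewrite eqEsubv subv_add; apply/andP; split.
    apply/andP; split; apply/subvP => f /span_pathsP fU;
    rewrite [f]pathalgE; apply: memv_suml => r _;
    (have [->|/fU/andP[Ir _]] := eqVneq (f r) 0; first by rewrite scale0r mem0v);
    exact: memvZ.
  apply/subvP => f If; rewrite [f]pathalgE; apply: memv_suml => r _.
  have [->|/(supp_coef If) Ir] := eqVneq (f r) 0; first by rewrite scale0r mem0v.
  apply: memvZ; have [Nr|Nr] := boolP (near r).
    by apply: (subvP (addvSl _ _)); rewrite -[_ \in _]/(r \in supp _) supp_span_paths unfold_in Ir.
  by apply: (subvP (addvSr _ _)); rewrite -[_ \in _]/(r \in supp _) supp_span_paths unfold_in Ir.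
- apply/eqP; rewrite -subv0; apply/subvP => f; rewrite memv_cap memv0.
  case/andP=> /span_pathsP f1 /span_pathsP f2; apply/eqP/ffunP => r; rewrite ffunE.
  apply/eqP; apply: contraT => fr.
  by have /andP[_ N1] := f1 r fr; have /andP[_ /negP[]] := f2 r fr.
- have : p \in supp J1 by rewrite supp_span_paths.
  by rewrite unfold_in J10 memv0 (negbTE (delta_neq0 p)).
(* Now [J2] is zero, so [q] cannot lie in [U2] and must be near. *)
apply: (near_all q) => //; apply: contraT => Nq.
have : q \in supp J2 by rewrite supp_span_paths unfold_in Iq.
by rewrite unfold_in J20 memv0 (negbTE (delta_neq0 q)).
Qed.

Lemma one_sided_indecomposable (hQ : admissible Q) I :
  (I : {vspace A}) <> 0%VS -> one_sided (supp I) -> indecomposable I.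
Proof.
move=> I0 sideI; split=> // J1 J2 J12 dJ.
have sJ p : (p \in [predU supp J1 & supp J2]) = (p \in supp I).
  apply/orP/idP => [[]|].
  - by rewrite !unfold_in -J12; apply: (subvP (addvSl _ _)).
  - by rewrite !unfold_in -J12; apply: (subvP (addvSr _ _)).
  (* The coefficients of [p] in [f] and [g] add up to 1, so one of them is nonzero. *)
  rewrite unfold_in -J12 => /memv_addP[f f1 [g g2 /ffunP/(_ p)]].
  rewrite !ffunE eqxx => fg.
  have [fp|/(supp_coef f1)] := eqVneq (f p) 0; last by left.
  by right; apply: (supp_coef g2); move: fg; rewrite fp add0r => <-; rewrite oner_neq0.
have [/existsP[p p1]|N1] := boolP [exists p, p \in supp J1]; last first.
  by left; apply: supp_eq0 => r; apply: contra N1 => r1; apply/existsP; exists r.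
have [/existsP[q q2]|N2] := boolP [exists q, q \in supp J2]; last first.
  by right; apply: supp_eq0 => r; apply: contra N2 => r2; apply/existsP; exists r.
have [|r r1 r2] := up_closed_meet hQ (@supp_up J1) (@supp_up J2) _ p1 q2.
  move=> i Ki; rewrite sJ => iI u v x y; rewrite !sJ; exact: sideI.
have : delta r \in (J1 :&: J2)%VS by rewrite memv_cap; apply/andP.
by rewrite dJ memv0 (negbTE (delta_neq0 r)).
Qed.

Lemma ideal_prod_subl I J : (I * J <= I)%VS.
Proof. by apply/prodvP => f g If _; apply: ideal_mulr. Qed.

Lemma ideal_prod_subr I J : (I * J <= J)%VS.
Proof. by apply/prodvP => f g _ Jg; apply: ideal_mull. Qed.

Lemma one_sided_prod I J :
  one_sided (supp I) -> one_sided (supp J) -> one_sided (supp (ideal_prod I J)).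
Proof.
move=> sI sJ i Ki eIJ p q x y IJp IJq.
have [iI|/sI] := boolP (idpath Q i \in supp I); last first.
  by apply=> //; apply: (subvP (ideal_prod_subl I J)).
have [iJ|/sJ] := boolP (idpath Q i \in supp J); last first.
  by apply=> //; apply: (subvP (ideal_prod_subr I J)).
case/negP: eIJ; rewrite unfold_in.
by rewrite -[delta _](@delta_concat (idpath Q i) (idpath Q i)) ?memv_mul //; apply: ends_is_concat.
Qed.

End PathAlgebraIdeals.

(** * The multiplication map on the tensor product *)

Section BimoduleTheory.
Variables (R S : pzRingType) (M : bimodType R S).
Implicit Types (m : M).

Lemma lact0 (a : R) : lact a 0 = 0 :> M.
Proof. by apply: (addrI (lact a 0)); rewrite -lactDr !addr0. Qed.

Lemma lactB (a : R) m m' : lact a (m - m') = lact a m - lact a m'.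
Proof. by apply: (addIr (lact a m')); rewrite -lactDr !subrK. Qed.

Lemma ract0 (a : S) : ract 0 a = 0 :> M.
Proof. by apply: (addrI (ract 0 a)); rewrite -ractDl !addr0. Qed.

Lemma ractB m m' (a : S) : ract (m - m') a = ract m a - ract m' a.
Proof. by apply: (addIr (ract m' a)); rewrite -ractDl !subrK. Qed.

End BimoduleTheory.

Section TensorMul.
Variables (k : fieldType) (A : falgType k) (I J : ideal A).
Local Notation IJ := (ideal_mod (ideal_prod I J)).
Local Notation T := (tensor (ideal_mod I) (ideal_mod J)).

Definition mul_pair (mn : ideal_mod I * ideal_mod J) : IJ :=
  Subvs (memv_mul (subvsP mn.1) (subvsP mn.2)).

(** [ssrint.zmodule] regards the group [IJ] as a module over the integers, as the lift from the free
    group requires. *)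
Definition freeg_mul : {freeg (ideal_mod I * ideal_mod J)%type} -> IJ :=
  fglift (mul_pair : _ -> ssrint.zmodule IJ).

Definition tensor_mul (t : T) : IJ := freeg_mul (repr t).

Let freeg_mulB x y : freeg_mul (x - y) = freeg_mul x - freeg_mul y.
Proof. exact: (lift_is_additive (mul_pair : _ -> ssrint.zmodule IJ) x y). Qed.

Let freeg_mulU m n : freeg_mul << (m, n) >> = mul_pair (m, n).
Proof. by rewrite /freeg_mul liftU scale1r. Qed.

(** Biadditivity comes from distributivity in [A], and balancedness from associativity. *)
Let freeg_mul_rel x : @tensor_rel A A A (ideal_mod I) (ideal_mod J) x -> freeg_mul x = 0.
Proof.
elim=> [m m' n|m n n'|m s n||{}x y _ rx _ ry].
- rewrite !freeg_mulB !freeg_mulU -addrA -opprD; apply/eqP; rewrite subr_eq0.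
  by apply/eqP/val_inj/mulrDl.
- rewrite !freeg_mulB !freeg_mulU -addrA -opprD; apply/eqP; rewrite subr_eq0.
  by apply/eqP/val_inj/mulrDr.
- rewrite !freeg_mulB !freeg_mulU; apply/eqP; rewrite subr_eq0.
  by apply/eqP/val_inj; rewrite /= mulrA.
- by rewrite -(subrr 0) freeg_mulB subrr.
- by rewrite freeg_mulB rx ry subrr.
Qed.

Let tensor_mul_pi x : tensor_mul (\pi_T x)%qT = freeg_mul x.
Proof.
apply/eqP; rewrite -subr_eq0 -freeg_mulB; apply/eqP/freeg_mul_rel/tensor_pi_rel.
exact: reprK.
Qed.

Lemma tensor_mul_is_zmod_morphism : zmod_morphism tensor_mul.
Proof.
move=> x y; rewrite -[x]reprK -[y]reprK -tensor_piB !tensor_mul_pi.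
exact: freeg_mulB.
Qed.
HB.instance Definition _ := GRing.isZmodMorphism.Build T IJ tensor_mul
  tensor_mul_is_zmod_morphism.

Lemma tensor_mulE m n : tensor_mul (tpure m n) = mul_pair (m, n).
Proof. by rewrite tensor_mul_pi freeg_mulU. Qed.

Lemma tensor_mul_surj x : exists t, tensor_mul t = x.
Proof.
suff [t tx] : exists t, \val (tensor_mul t) = \val x by exists t; apply: val_inj.
case: x => x /= xIJ.
(* The product space is by definition the span of the products of basis vectors. *)
have /coord_span -> : x \in <<allpairs *%R (vbasis I) (vbasis J)>>%VS.
  by rewrite -(congr1 (fun F => F (I : {vspace A}) (J : {vspace A})) (unlock (prodv_unlockable A))).
apply: (big_ind (fun v => exists t, \val (tensor_mul t) = v))
  => [|y z [t <-] [u <-]|i _]; first by exists 0; rewrite raddf0.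
  by exists (t + u); rewrite raddfD.
set c := coord _ i x; set X := (X in X`_i).
have [[u v] /= [uI vJ ->]] : exists uv, [/\ uv.1 \in vbasis I, uv.2 \in vbasis J
    & X`_i = uv.1 * uv.2].
  by apply/allpairsP/mem_nth; rewrite size_allpairs !size_tuple.
have cuI := memvZ c (vbasis_mem uI).
exists (tpure (Subvs cuI : ideal_mod I) (Subvs (vbasis_mem vJ) : ideal_mod J)).
by rewrite tensor_mulE /= scalerAl.
Qed.

Lemma tensor_mul_lact a t : tensor_mul (lact a t) = lact a (tensor_mul t).
Proof.
elim/tensor_ind: t => [|m n|x y ex ey]; first by rewrite lact0 raddf0 lact0.
  by rewrite [lact _ _]tensor_lactE !tensor_mulE; apply: val_inj; rewrite /= mulrA.
by rewrite lactB !tensor_mul_is_zmod_morphism lactB ex ey.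
Qed.

Lemma tensor_mul_ract t a : tensor_mul (ract t a) = ract (tensor_mul t) a.
Proof.
elim/tensor_ind: t => [|m n|x y ex ey]; first by rewrite ract0 raddf0 ract0.
  by rewrite [ract _ _]tensor_ractE !tensor_mulE; apply: val_inj; rewrite /= mulrA.
by rewrite ractB !tensor_mul_is_zmod_morphism ractB ex ey.
Qed.

(** With surjectivity known, a mere left inverse suffices; [g] may be any function. *)
Lemma tensor_mul_bimod_iso g : cancel tensor_mul g -> bimod_iso T IJ.
Proof.
move=> mulK; exists tensor_mul.
split; [|exact: tensor_mul_lact|exact: tensor_mul_ract].
by exists g => // x; have [t <-] := tensor_mul_surj x; rewrite mulK.
Qed.

(** The tensor product is balanced over [A], and [c] acts as the element [c%:A]. *)
Lemma tpureZ (c : k) m n : tpure (c *: m : ideal_mod I) (n : ideal_mod J) = tpure m (c *: n).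
Proof.
have -> : c *: m = ract m (c%:A : A).
  by apply: val_inj; rewrite /= -scalerAr mulr1.
by rewrite tpure_balanced; congr tpure; apply: val_inj; rewrite /= -scalerAl mul1r.
Qed.

End TensorMul.

(** * The inverse of the multiplication map *)

Section PathTensor.
Variables (k : fieldType) (n : nat) (Q : oriented_tree n).
Variables (I J : ideal (pathalg k Q)).
Local Notation A := (pathalg k Q).
Implicit Types (p q r u : qpath Q) (a : k).

(** The projection makes this total in [p]; it represents the path [p] only for [p] in [supp K]. *)
Definition path_elt (K : ideal A) p : ideal_mod K := vsproj K (delta k p).

Lemma val_path_elt (K : ideal A) p : p \in supp K -> val (path_elt K p) = delta k p.
Proof. exact: vsprojK. Qed.

Lemma ideal_mod_ind (K : ideal A) (P : ideal_mod K -> Prop) :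
  P 0 -> (forall x y, P x -> P y -> P (x + y)) ->
  (forall a p, p \in supp K -> P (a *: path_elt K p)) -> forall x, P x.
Proof.
move=> P0 PD PZ x.
have -> : x = \sum_p (val x p : k) *: path_elt K p.
  rewrite -[LHS]vsvalK {1}[vsval x]pathalgE linear_sum.
  by apply: eq_bigr => p _; rewrite linearZ.
apply: big_ind => // p _; have [->|] := eqVneq (val x p) 0; first by rewrite scale0r.
by move/(supp_coef (subvsP x)); apply: PZ.
Qed.

(** Both [p] and [p'] are initial segments of [r]; what the longer adds to the shorter joins their
    targets. *)
Lemma concat_comparable p q p' q' r : is_concat p q r -> is_concat p' q' r ->
  connect (arrow Q) (target p) (target p') || connect (arrow Q) (target p') (target p).
Proof.
wlog le : p q p' q' / (size (steps p) <= size (steps p'))%N => [wl c c'|].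
  by case/orP: (leq_total (size (steps p)) (size (steps p'))) => /wl => [|w];
    [apply; eassumption | rewrite orbC; apply: w; eassumption].
move=> /and3P[_ /eqP sp /eqP e] /and3P[_ /eqP sp' /eqP e'].
have def_p : steps p = take (size (steps p)) (steps p').
  by rewrite -(takel_cat (steps q') le) -e' e take_size_cat.
apply/orP; left; apply/connectP; exists (drop (size (steps p)) (steps p')).
  have : path (arrow Q) (source p') (steps p') by case: (p').
  rewrite -{1}(cat_take_drop (size (steps p)) (steps p')) cat_path -def_p.
  by case/andP=> _; rewrite /target -sp sp'.
rewrite {1}/target -{1}(cat_take_drop (size (steps p)) (steps p')) last_cat.
by rewrite -def_p -sp' sp.
Qed.

(* The part between two cutting points of [r] can be moved across the tensor
   sign, so the element attached to [r] does not depend on the cut. *)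
Lemma tpure_split a p q p' q' r : is_concat p q r -> is_concat p' q' r ->
  p \in supp I -> q \in supp J -> p' \in supp I -> q' \in supp J ->
  tpure (a *: path_elt I p) (path_elt J q) = tpure (a *: path_elt I p') (path_elt J q').
Proof.
wlog : p q p' q' / connect (arrow Q) (target p) (target p') => [wl c c' Ip Jq Ip' Jq'|].
  by have /orP[/wl|/wl w] := concat_comparable c c'; [apply | apply/esym/w].
move=> /reach_qpath[u su tu] /is_concat_ends[tp sr tr] /is_concat_ends[tp' sr' tr'].
have pu : is_concat p u p' by apply: ends_is_concat; congruence.
have uq : is_concat u q' q by apply: ends_is_concat; congruence.
move=> Ip Jq Ip' Jq'.
have -> : a *: path_elt I p' = ract (a *: path_elt I p) (delta k u).
  apply: val_inj; rewrite /= -[vsval _]/(val _) val_path_elt //.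
  by rewrite -[vsval _]/(val _) val_path_elt // -scalerAl (delta_concat _ pu).
rewrite tpure_balanced; congr tpure; apply: val_inj => /=.
by rewrite -![vsval _]/(val _) !val_path_elt // (delta_concat _ uq).
Qed.

(* Junk value [(r, r)] when [r] does not factor through [supp I] and [supp J]. *)
Definition path_split r : qpath Q * qpath Q :=
  odflt (r, r) [pick pq | [&& is_concat pq.1 pq.2 r, pq.1 \in supp I & pq.2 \in supp J]].

(** Additive because it depends linearly on the coefficients of [x], with one chosen factorization
    per path. *)
Definition unmul (x : ideal_mod (ideal_prod I J)) : tensor (ideal_mod I) (ideal_mod J) :=
  \sum_r tpure ((val x r : k) *: path_elt I (path_split r).1) (path_elt J (path_split r).2).

Lemma tpure0l (m : ideal_mod J) : tpure (0 : ideal_mod I) m = 0.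
Proof. by apply: (addrI (tpure 0 m)); rewrite -tpureDl !addr0. Qed.

Lemma tpure0r (m : ideal_mod I) : tpure m (0 : ideal_mod J) = 0.
Proof. by apply: (addrI (tpure m 0)); rewrite -tpureDr !addr0. Qed.

Lemma unmul0 : unmul 0 = 0.
Proof. by apply: big1 => r _; rewrite ffunE scale0r tpure0l. Qed.

Lemma unmulD x y : unmul (x + y) = unmul x + unmul y.
Proof.
by rewrite /unmul -big_split; apply: eq_bigr => r _; rewrite ffunE scalerDl tpureDl.
Qed.

Lemma unmulB x y : unmul (x - y) = unmul x - unmul y.
Proof. by apply: (addIr (unmul y)); rewrite -unmulD !subrK. Qed.

Lemma unmul_path x a p q r : is_concat p q r -> p \in supp I -> q \in supp J ->
  val x = a *: delta k r -> unmul x = tpure (a *: path_elt I p) (path_elt J q).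
Proof.
move=> pqr Ip Jq xr; rewrite /unmul xr (bigD1 r) //= big1 ?addr0 => [|s /negbTE sr].
  have -> : (a *: delta k r) r = a by rewrite !ffunE eqxx [_ *: _]mulr1.
  rewrite /path_split; case: pickP => /=.
    (* The chosen cut of [r] may differ from [(p, q)], but gives the same tensor. *)
    by move=> [p' q'] /and3P[c Ip' Jq']; apply: tpure_split c pqr _ _ _ _.
  by move/(_ (p, q)); rewrite /= pqr Ip Jq.
have -> : (a *: delta k r) s = 0 by rewrite !ffunE sr [_ *: _]mulr0.
by rewrite scale0r tpure0l.
Qed.

(** By additivity and [tpureZ] it is enough to treat multiples of tensors of two paths, composable
    or not. *)
Lemma tensor_mulK : cancel (@tensor_mul _ _ I J) unmul.
Proof.
elim/tensor_ind => [|m l|x y ex ey]; first by rewrite raddf0 unmul0.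
  move: l; elim/ideal_mod_ind: m => [l|m m' em em' l|a p Ip].
  - by rewrite tpure0l raddf0 unmul0.
  - by rewrite tpureDl raddfD unmulD em em'.
  apply: ideal_mod_ind => [|l l' el el'|b q Jq].
  - by rewrite tpure0r raddf0 unmul0.
  - by rewrite tpureDr raddfD unmulD el el'.
  rewrite -tpureZ scalerA tensor_mulE; set c := b * a.
  have [pq|pq] := eqVneq (target p) (source q).
    have [r pqr] := is_concat_exists pq.
    rewrite (@unmul_path _ c _ _ _ pqr Ip Jq) //; rewrite /= -![vsval _]/(val _) !val_path_elt //.
    by rewrite -scalerAl (delta_concat _ pqr).
  rewrite (_ : mul_pair _ = 0); last first.
    apply: val_inj; rewrite /= -![vsval _]/(val _) !val_path_elt //.
    by rewrite -scalerAl delta_mul_neq // scaler0.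
  rewrite unmul0.
  (* The trivial path at the target of [p] fixes [p] on the right; moved across the tensor sign it
     kills [q], which starts elsewhere. *)
  have -> : c *: path_elt I p = ract (c *: path_elt I p) (delta k (idpath Q (target p))).
    apply: val_inj; rewrite /= -![vsval _]/(val _) !val_path_elt //.
    by rewrite -scalerAl delta_idr eqxx.
  rewrite tpure_balanced (_ : lact _ _ = 0) ?tpure0r //.
  apply: val_inj; rewrite /= -![vsval _]/(val _) !val_path_elt //.
  by rewrite delta_idl (negbTE pq).
by rewrite raddfB unmulB ex ey.
Qed.

End PathTensor.

Theorem proposition45 (k : closedFieldType) (n : nat) (Q : oriented_tree n)
    (hn : (1 < n)%N) (hQ : admissible Q) (hK' : Kset' Q != set0)
    (B D : ideal (pathalg k Q))
    (hB : indecomposable B) (hD : indecomposable D) :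
  bimod_iso (tensor (ideal_mod B) (ideal_mod D)) (ideal_mod (ideal_prod B D)) /\
  ((B * D)%VS = 0%VS \/ indecomposable (ideal_prod B D)).
Proof.
split; first exact: tensor_mul_bimod_iso (@tensor_mulK _ _ _ B D).
have [|BD0] := pselect ((B * D)%VS = 0%VS); first by left.
right; apply: one_sided_indecomposable => //.
by apply: one_sided_prod; apply: indecomposable_one_sided.
Qed.
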